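(* For every numerical set $S$, the partition $\lambda=\phi(S)$ satisfies $Hk(\lambda)=(\mathbb{N}\cup\{0\})\setminus A(S)$. In particular, for every positive integer $k$, $\phi(S)$ is a $k$-core if and only if $k\in A(S)$.
   Context: A numerical set is a subset $S\subseteq\mathbb{N}\cup\{0\}$ with $0\in S$ and finite complement. Its atom monoid is $A(S)=\{n\in\mathbb{N}\cup\{0\}: n+s\in S \text{ for all } s\in S\}$. If $S\neq\mathbb{N}\cup\{0\}$, let $f$ be the largest element of $(\mathbb{N}\cup\{0\})\setminus S$ (the Frobenius number). Define $\phi(S)$ to be the partition whose profile (the outer boundary lattice path of the Young diagram, traversed from the bottom-left corner to the top-right corner, consisting of east and north unit steps) has steps numbered $0,1,\dots,f$, where step $i$ is an east step if $i\in S$ and a north step if $i\notin S$; equivalently, $\phi(S)$ is the partition whose parts are the numbers $|\{s\in S: s<g\}|$ for $g$ ranging over $(\mathbb{N}\cup\{0\})\setminus S$. If $S=\mathbb{N}\cup\{0\}$, $\phi(S)$ is the empty partition. For a partition $\lambda=(\lambda_1\ge\dots\ge\lambda_\ell\ge1)$, the hook length of cell $(i,j)$ is $h_{ij}=\lambda_i-j+\lambda'_j-i+1$ with $\lambda'_j=|\{a:\lambda_a\ge j\}|$; $Hk(\lambda)$ is the set of all hook lengths; and $\lambda$ is a $k$-core if no element of $Hk(\lambda)$ is a multiple of $k$. *)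

(* Defs.v *)
From mathcomp Require Import all_boot finmap all_classical.

Set Implicit Arguments.
Unset Strict Implicit.
Unset Printing Implicit Defensive.

Local Open Scope classical_set_scope.
Local Open Scope nat_scope.

Record numset := NumSet {
  numset_set :> set nat;
  numset0 : numset_set 0;
  numset_cofinite : finite_set (~` numset_set) }.

Definition atom_monoid (S : set nat) : set nat :=
  [set n | forall s, S s -> S (n + s)].

Definition gaps (S : numset) : {fset nat} := fset_set (~` S).

(* The largest gap; junk value 0 when there is no gap. *)
Definition frobenius (S : numset) : nat := \max_(g <- gaps S) g.

Record intpart := IntPart {
  parts :> seq nat;
  partsP : sorted geq parts && (0 \notin parts) }.

(* Cells are numbered from 1, so part l i is the i-th part for 1 <= i, and 0
   beyond the last row. *)
Definition part (l : intpart) (i : nat) : nat := nth 0 l i.-1.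

Definition conj_part (l : intpart) (j : nat) : nat := count (leq j) l.

Definition cell (l : intpart) (i j : nat) : bool :=
  (0 < i <= size l) && (0 < j <= part l i).

(* On cells neither truncated subtraction truncates. *)
Definition hook_length (l : intpart) (i j : nat) : nat :=
  part l i - j + conj_part l j - i + 1.

Definition Hk (l : intpart) : set nat :=
  [set h | exists i j, cell l i j /\ h = hook_length l i j].

Definition is_core (k : nat) (l : intpart) : Prop :=
  forall h, Hk l h -> ~~ (k %| h).

(* East steps are true and north steps are false. The path starts at the
   bottom-left corner, hence meets the shortest row first. *)
Definition profile (l : intpart) : seq bool :=
  flatten (pairmap (fun a b => rcons (nseq (b - a) true) false) 0 (rev l)).

Definition steps (S : numset) : seq bool :=
  if S == setT :> set nat then [::]
  else mkseq (fun i => i \in (S : set nat)) (frobenius S).+1.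

Definition count_below (S : set nat) (g : nat) : nat :=
  count (fun s => s \in S) (iota 0 g).

Lemma phi_subproof (S : numset) :
  let s := sort geq [seq count_below S g | g <- gaps S] in
  sorted geq s && (0 \notin s).
Proof.
rewrite /= sort_sorted; last by move=> m n; exact: leq_total.
rewrite mem_sort; apply/mapP => -[g].
rewrite in_fset_set; last exact: numset_cofinite.
rewrite inE /=; case: g => [/(_ (numset0 S)) //|g _].
by rewrite /count_below /= mem_set //; exact: numset0.
Qed.

(* phi S is also the unique partition whose profile is steps S: see profile_phi
   and profile_inj below. *)
Definition phi (S : numset) : intpart := IntPart (phi_subproof S).

Lemma profile_inj (l m : intpart) : profile l = profile m -> l = m :> seq nat.
Proof.
have srt (p : intpart) : path leq 0 (rev p).
  have /andP[sp _] := partsP p.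
  by rewrite path_min_sorted ?rev_sorted //; apply/allP.
rewrite /profile => eq_lm; apply: (can_inj revK).
move: (rev l) (rev m) (srt l) (srt m) eq_lm => {srt l m} p q.
elim: p 0 q => [|a p IHp] x [|b q] //=.
- by case: (b - x).
- by case: (a - x).
case/andP=> lexa pp /andP[lexb pq]; rewrite !cat_rcons.
have nseqI c d u v : nseq c true ++ false :: u = nseq d true ++ false :: v ->
    c = d /\ u = v.
  by elim: c d => [[|d] //= [] | c IHc [|d] //= [] /IHc[-> ->]].
case/nseqI => eq_ab; have {eq_ab} eq_ab : a = b.
  by rewrite -(subnK lexa) eq_ab subnK.
by rewrite eq_ab in pp * => /IHp -> //.
Qed.

Lemma profile_phi (S : numset) : profile (phi S) = steps S.
Proof.
have gapsE g : (g \in gaps S) = (g \notin (S : set nat)).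
  rewrite in_fset_set; last exact: numset_cofinite.
  by rewrite in_setC.
rewrite /steps; case: eqP => [ST|/eqP SnT].
  suff g0 : gaps S = fset0 by rewrite /profile /= g0.
  by rewrite /gaps ST setCT fset_set0.
pose p i := i \in (S : set nat); set c := count_below S.
have cS n : c n.+1 = c n + p n.
  by rewrite /c /count_below -addn1 iotaD count_cat /= addn0.
have le_c : {homo c : m n / m <= n}.
  by move=> m n /subnK <-; elim: (n - m) => // k IHk; 
    rewrite addSn cS (leq_trans IHk) ?leq_addr.
have le_frob g : ~~ p g -> g <= frobenius S.
  by rewrite -gapsE => gS; rewrite /frobenius (leq_bigmax_seq _ gS).
pose rows n := [seq c g | g <- iota 0 n & ~~ p g].
have -> : profile (phi S) = flatten (pairmap
    (fun a b => rcons (nseq (b - a) true) false) 0 (rows (frobenius S).+1)).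
  rewrite /profile; congr (flatten (pairmap _ _ _)).
  apply: (@sorted_eq _ leq leq_trans anti_leq).
  - by rewrite rev_sorted; have /andP[] := partsP (phi S).
  - rewrite /rows; apply: (homo_sorted le_c).
    by apply: sorted_filter; [exact: leq_trans | exact: iota_sorted].
  - rewrite perm_rev perm_sort; apply: perm_map; apply: uniq_perm.
    + exact: fset_uniq.
    + by rewrite filter_uniq // iota_uniq.
    + move=> g; rewrite gapsE mem_filter mem_iota /= add0n ltnS.
      by rewrite -/(p g); case: (boolP (p g)) => //= /le_frob ->.
have last_le n : last 0 (rows n) <= c n.
  elim: n => // n IHn; rewrite /rows -addn1 iotaD filter_cat /= add0n addn1.
  case: ifP => pn; rewrite ?cats0; last by rewrite (leq_trans IHn) // cS leq_addr.
  by rewrite map_cat last_cat /= cS leq_addr.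
have main n : flatten (pairmap (fun a b => rcons (nseq (b - a) true) false) 0
    (rows n)) ++ nseq (c n - last 0 (rows n)) true = mkseq p n.
  elim: n => // n IHn; rewrite /mkseq -addn1 iotaD map_cat -/(mkseq p n) -IHn.
  rewrite /rows iotaD filter_cat map_cat /= -/(rows n) addn1 cS.
  case: (boolP (p n)) => pn /=; rewrite ?cats0.
    by rewrite -addnBAC // nseqD catA.
  rewrite pairmap_cat flatten_cat last_cat /= cats0 addn0 subnn cats0.
  by rewrite -cats1 catA.
rewrite -main.
have pf : ~~ p (frobenius S).
  have : gaps S != fset0.
    apply: contra SnT => /eqP g0; apply/eqP/seteqP; split=> // g _.
    have := gapsE g; rewrite g0 in_fset0 => /esym/negbFE.
    by rewrite inE.
  case/fset0Pn => g gS; rewrite -gapsE /frobenius.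
  have [h hS ->] : exists2 h, h \in gaps S & \max_(g <- gaps S) g = h.
    rewrite big_tnth.
    have lt0 : 0 < #|'I_(size (gaps S))|.
      by rewrite card_ord cardfs_gt0; apply/fset0Pn; exists g.
    have [i ->] := eq_bigmax (tnth (in_tuple (gaps S))) lt0.
    by eexists; last reflexivity; exact: mem_tnth.
  exact: hS.
rewrite /rows -addn1 iotaD filter_cat map_cat /= pf last_cat /= addn1 cS.
by rewrite (negbTE pf) addn0 subnn cats0.
Qed.

(* Main.v *)
Require Import Defs.
From mathcomp Require Import all_boot finmap all_classical.
Local Open Scope classical_set_scope.
Local Open Scope nat_scope.

(** The rows of [phi S] correspond to the gaps [g] of [S] and its columns to the
    elements [s] of [S], the cells being the pairs with [s < g]. The arm of such
    a cell counts the elements of [S] strictly between [s] and [g], and its leg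
    the gaps strictly between them, so that its hook length is [g - s]. *)

(** In a strictly decreasing sequence the entries at least [x] are those up to and including [x].
    For the gaps this count is the row number, starting from 1. *)
Lemma count_leq_index (s : seq nat) (x : nat) :
  sorted gtn s -> x \in s -> count (leq x) s = (index x s).+1.
Proof.
elim: s => // y s IHs /= ys; rewrite inE eq_sym.
have /allP lt_y : all (gtn y) s.
  by apply: order_path_min ys => a b c /= ba cb; exact: ltn_trans cb ba.
case: eqVneq => [<- _|yx /= xs].
  rewrite leqnn (@eq_in_count _ _ pred0) ?count_pred0 // => z /lt_y /= zy.
  by rewrite leqNgt zy.
by rewrite (ltnW (lt_y x xs)) IHs // (path_sorted ys).
Qed.

Lemma count_belowD (S : set nat) (m n : nat) :
  count_below S (m + n) =
  count_below S m + count (fun s => s \in S) (iota m n).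
Proof. by rewrite /count_below iotaD count_cat. Qed.

Lemma leq_count_below (S : set nat) : {homo count_below S : m n / m <= n}.
Proof. by move=> m n /subnKC <-; rewrite count_belowD leq_addr. Qed.

Lemma count_belowS (S : set nat) (n : nat) :
  count_below S n.+1 = count_below S n + (n \in S).
Proof. by rewrite -addn1 count_belowD /= addn0. Qed.

(** The element [s] is itself counted on passing from [s] to [s.+1], which makes the inequality
    strict. The condition for being a cell thus turns into [s < g]. *)
Lemma ltn_count_below (S : set nat) (s g : nat) :
  s \in S -> (count_below S s < count_below S g) = (s < g).
Proof.
move=> sS; apply/idP/idP => [|sg].
  by apply: contraTT; rewrite -!leqNgt; exact: leq_count_below.
by apply: leq_trans (leq_count_below S _ _ sg); rewrite count_belowS sS addn1.
Qed.

(** The count starts at 0 and rises by one exactly on passing an element of [S], so it skips no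
    value. Hence every column comes from an element of [S]. *)
Lemma count_below_onto (S : set nat) (g j : nat) :
  j < count_below S g -> exists2 s, s \in S & s < g /\ count_below S s = j.
Proof.
elim: g => // g IHg; rewrite count_belowS.
case: (boolP (g \in S)) => gS; last first.
  by rewrite addn0 => /IHg[s sS [sg <-]]; exists s => //; rewrite leqW.
rewrite addn1 ltnS leq_eqVlt => /predU1P[->|/IHg[s sS [sg <-]]].
  by exists g.
by exists s => //; rewrite leqW.
Qed.

Lemma mem_gaps (S : numset) (g : nat) :
  (g \in gaps S) = (g \notin (S : set nat)).
Proof. by rewrite in_fset_set ?in_setC //; exact: numset_cofinite. Qed.

Definition gap_seq (S : numset) : seq nat := sort geq (gaps S).

Lemma mem_gap_seq (S : numset) (g : nat) :
  (g \in gap_seq S) = (g \notin (S : set nat)).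
Proof. by rewrite mem_sort mem_gaps. Qed.

Lemma gap_seq_sorted (S : numset) : sorted gtn (gap_seq S).
Proof.
rewrite gtn_sorted_uniq_geq sort_uniq fset_uniq sort_sorted //.
by move=> m n; exact: leq_total.
Qed.

(** As [count_below S] is monotone, sorting the gaps first gives the same sequence as sorting the
    counts. This ties each row to one gap, even among rows of equal length. *)
Lemma parts_phi (S : numset) :
  phi S = [seq count_below S g | g <- gap_seq S] :> seq nat.
Proof.
apply: (@sorted_eq _ geq).
- by move=> a b c /= ba cb; exact: leq_trans cb ba.
- by move=> a b /andP[ba ab]; apply/anti_leq/andP.
- by have /andP[] := partsP (phi S).
- apply: (@homo_sorted _ _ _ geq geq).
    by move=> m n; exact: leq_count_below.
  by have := gap_seq_sorted S; rewrite gtn_sorted_uniq_geq => /andP[].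
- by rewrite perm_sort perm_sym; apply: perm_map; rewrite perm_sort.
Qed.

Lemma count_gap_seq (S : numset) (m n : nat) :
  count (fun h => m <= h < m + n) (gap_seq S) =
  count (fun h => h \notin (S : set nat)) (iota m n).
Proof.
rewrite -!size_filter; apply/perm_size/uniq_perm.
- by rewrite filter_uniq // sort_uniq fset_uniq.
- by rewrite filter_uniq // iota_uniq.
- by move=> h; rewrite !mem_filter mem_gap_seq mem_iota andbC.
Qed.

Section HookOfGap.
Context (S : numset) (s g : nat).
Hypotheses (sS : s \in (S : set nat)) (gS : g \notin (S : set nat)).
Hypothesis (sg : s < g).

(** Rows and columns are numbered from 1, hence the successors. *)
Let i := (index g (gap_seq S)).+1.
Let j := (count_below S s).+1.

Lemma part_phi_gap : part (phi S) i = count_below S g.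
Proof.
have gG : g \in gap_seq S by rewrite mem_gap_seq.
by rewrite /part parts_phi (nth_map 0) ?index_mem ?nth_index.
Qed.

Lemma cell_phi_gap : cell (phi S) i j.
Proof.
rewrite /cell part_phi_gap ltn_count_below // sg parts_phi size_map.
by rewrite index_mem mem_gap_seq gS.
Qed.

Lemma hook_length_phi_gap : hook_length (phi S) i j = g - s.
Proof.
have gE : g = s.+1 + (g - s.+1) by rewrite subnKC.
have arm : count_below S g =
    j + count (fun x => x \in (S : set nat)) (iota s.+1 (g - s.+1)).
  by rewrite {1}gE count_belowD count_belowS sS addn1.
have leg : conj_part (phi S) j =
    i + count (fun x => x \notin (S : set nat)) (iota s.+1 (g - s.+1)).
  (* The gaps above [s] split into those at least [g], which are [i] in number, and those strictly
     between [s] and [g]. *)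
  rewrite /i -count_leq_index ?gap_seq_sorted ?mem_gap_seq //.
  rewrite -count_gap_seq -gE /conj_part parts_phi count_map.
  rewrite -count_predUI [X in _ + X](@eq_count _ _ pred0) => [|h /=].
    rewrite count_pred0 addn0; apply: eq_count => h /=.
    rewrite ltn_count_below //; case: (leqP g h) => [gh|]; last by rewrite andbT.
    by rewrite (leq_trans sg gh).
  by case: (leqP g h); rewrite ?andbF.
(* Each integer strictly between [s] and [g] is counted once, in the arm or in the leg; the cell
   itself adds 1. *)
rewrite /hook_length part_phi_gap arm leg addKn addnCA addKn count_predC size_iota.
by rewrite addn1 subnSK.
Qed.
End HookOfGap.

Lemma Hk_phi (S : numset) (h : nat) :
  Hk (phi S) h <->
  exists s g, [/\ s \in (S : set nat), g \notin (S : set nat), s < g & h = g - s].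
Proof.
split=> [[i [j [/andP[/andP[i0 iG] /andP[j0 jg]] ->]]]|[s [g [sS gS sg ->]]]].
  rewrite parts_phi size_map in iG.
  (* The default 0 is not reached, since [i] is at most the number of gaps. *)
  pose g := nth 0 (gap_seq S) i.-1.
  have gS : g \notin (S : set nat) by rewrite -mem_gap_seq mem_nth // prednK.
  have iE : i = (index g (gap_seq S)).+1.
    by rewrite index_uniq ?prednK // sort_uniq fset_uniq.
  rewrite iE part_phi_gap // -(prednK j0) in jg.
  have [s sS [sg sj]] := count_below_onto _ _ _ jg.
  exists s, g; split=> //.
  by rewrite iE -(prednK j0) -sj hook_length_phi_gap.
exists (index g (gap_seq S)).+1, (count_below S s).+1.
by rewrite cell_phi_gap // hook_length_phi_gap.
Qed.

(** Shifting by [k] stays in [S], hence so does doing it [m] times. This excludes all multiples of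
    [k] as hook lengths, not only [k]. *)
Lemma atom_monoidM (S : set nat) (k m : nat) :
  atom_monoid S k -> atom_monoid S (m * k).
Proof.
move=> kA; elim: m => [|m IHm] s sS; first by rewrite mul0n.
by rewrite mulSn -addnA; apply/kA/IHm.
Qed.

Theorem theorem4 (S : numset) :
  Hk (phi S) = ~` atom_monoid S /\
  (forall k : nat, 0 < k -> (is_core k (phi S) <-> atom_monoid S k)).
Proof.
have HkE : Hk (phi S) = ~` atom_monoid S.
  apply/seteqP; split=> h.
    move/Hk_phi => [s [g [/set_mem sS /negP gS sg ->]]] /(_ s sS).
    by rewrite subnK ?(ltnW sg) // => /mem_set.
  move/existsNP => [s /not_implyP[sS hsS]]; apply/Hk_phi; exists s, (h + s).
  split; rewrite ?addnK //; [exact: mem_set | by apply/negP => /set_mem |].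
  (* Here [h] is nonzero because [s] lies in [S] and [h + s] does not. *)
  by case: h hsS => [//|h _]; rewrite addSn ltnS leq_addl.
split=> // k _; split=> [core_k|kA h].
  apply: contrapT => kNA; have := core_k k.
  by rewrite HkE dvdnn => /(_ kNA).
rewrite HkE => hNA; apply/negP => /dvdnP[m hE].
by apply: hNA; rewrite hE; exact: atom_monoidM.
Qed.
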